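(* For every integer $n\ge0$, every $i\in\{0,2\}$ and every $m\in\{0,1,2,3,4\}$, the number of partitions $\pi$ of $5n+4$ with $\mathrm{srank}(\pi)\equiv i\pmod 4$ and $\text{2-quotient-rank}(\pi)\equiv m\pmod 5$ equals $\tfrac15 p_i(5n+4)$.
   Context: For a partition $\pi$, $\pi'$ is its conjugate, $\mathcal O(\pi)$ the number of odd parts, $\mathrm{srank}(\pi)=\mathcal O(\pi)-\mathcal O(\pi')$, and $p_i(n)$ ($i=0,2$) the number of partitions of $n$ with $\mathrm{srank}\equiv i\pmod 4$. $\nu(\pi)$ denotes the number of (positive) parts of $\pi$. $t$-quotient (here $t=2$): for $\pi=(\lambda_1\ge\lambda_2\ge\cdots)$ with $\lambda_j=0$ for $j$ large, let $S=\{\lambda_j-j: j\ge1\}\subset\mathbb Z$, and for $0\le c\le t-1$ let $S_c=\{k\in\mathbb Z: tk+c\in S\}$. Then $\hat\pi_c$ is the partition whose parts are the numbers $\#\{s\in S_c: s>g\}$ as $g$ ranges over the integers not in $S_c$ (only finitely many are positive). The 2-quotient of $\pi$ is $(\hat\pi_0,\hat\pi_1)$ (for $t=2$), and $\text{2-quotient-rank}(\pi)=\nu(\hat\pi_0)-\nu(\hat\pi_1)$. *)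

(* Defs.v *)
From mathcomp Require Import all_boot all_order all_algebra.
Set Implicit Arguments. Unset Strict Implicit. Unset Printing Implicit Defensive.
Import Order.TTheory GRing.Theory Num.Theory.

(* A partition is represented by the seq of its positive parts in
   nonincreasing order: lambda_1 >= lambda_2 >= ... >= lambda_l > 0. *)

Definition conjp (l : seq nat) : seq nat :=
  [seq count (fun x => j < x) l | j <- iota 0 (head 0 l)].

Definition nodd (l : seq nat) : nat := count odd l.

Definition srank (l : seq nat) : int := (nodd l)%:Z - (nodd (conjp l))%:Z.

(* lambda_j (1-indexed, 0 beyond the length) *)
Definition lam (l : seq nat) (j : nat) : nat := nth 0 l j.-1.

(* membership in S = { lambda_j - j : j >= 1 }.  If lambda_j - j = x then
   j <= max(size l, |x|), so searching j in 1 .. size l + |x| is exhaustive. *)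
Definition inS (l : seq nat) (x : int) : bool :=
  has (fun j => ((lam l j)%:Z - j%:Z == x)%R) (iota 1 (size l + `|x|%N)).

Definition inSc (l : seq nat) (c : nat) (k : int) : bool :=
  inS l (2 * k + c%:Z)%R.

Definition window (B : nat) : seq int :=
  [seq (z%:Z - B%:Z)%R | z <- iota 0 (2 * B).+1].

(* Parts (including zeros) of the c-th 2-quotient component:
   #{ s in S_c : s > g } for g an integer not in S_c.  Every g not in S_c
   giving a positive value, and every s in S_c counted, lies in
   [-B, B] with B = sumn l + size l, so restricting to this window loses
   only zero parts. *)
Definition quot_parts (l : seq nat) (c : nat) : seq nat :=
  let B := sumn l + size l in
  [seq count (fun s => inSc l c s && (g < s)%R) (window B)
  | g <- window B & ~~ inSc l c g].

Definition nu (p : seq nat) : nat := count (fun x => 0 < x) p.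

Definition quot2_rank (l : seq nat) : int :=
  (nu (quot_parts l 0))%:Z - (nu (quot_parts l 1))%:Z.

(* Partitions of n are encoded as nonincreasing functions
   'I_n -> 'I_n.+1 with sum n (padded with zeros); the partition is the
   subsequence of positive entries.  This is a bijection with the set of
   partitions of n. *)
Definition fseq n (f : {ffun 'I_n -> 'I_n.+1}) : seq nat :=
  [seq val (f i) | i <- enum 'I_n].

Definition ptn_of n (f : {ffun 'I_n -> 'I_n.+1}) : seq nat :=
  [seq x <- fseq f | 0 < x].

Definition card_ptn (n : nat) (P : seq nat -> bool) : nat :=
  #|[set f : {ffun 'I_n -> 'I_n.+1} |
     sorted geq (fseq f) && (sumn (fseq f) == n) && P (ptn_of f)]|.

Definition srank_mod (i : nat) (l : seq nat) : bool :=
  ((srank l - i%:Z)%R %% 4 == 0)%Z.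

Definition p_i (i n : nat) : nat := card_ptn n (srank_mod i).

(* Main.v *)
(* A partition in an L x L box (L even) is its boundary path, a word of L [true]
   and L [false] letters, and its 2-quotient consists of the two words of letters
   in even and in odd position.  If the even word has L / 2 + d letters [true] and
   N is the total size of the quotient, then
     |pi| = 2 N + 2 d^2 - d   and   srank(pi) = |pi| - d  (mod 4),
   so for fixed |pi| = 5 n + 4 both srank mod 4 and N depend only on d, and
   N mod 5 is always 2, 3 or 4.  It remains to see that the rank of pairs of
   partitions of total size N is equidistributed mod 5 for each such N.  At a
   primitive 5th root of unity z the generating function 1/((zq)(q/z)) equals
   (q)(z^2 q)(q/z^2)/(q^5;q^5), and by the Jacobi triple product the coefficients
   of the numerator vanish at all exponents that are 2, 3 or 4 mod 5. *)
Require Import Defs.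
From mathcomp Require Import all_boot all_order all_algebra all_field.
From mathcomp Require Import zify ring.
Import Order.TTheory GRing.Theory Num.Theory.
Set Implicit Arguments. Unset Strict Implicit. Unset Printing Implicit Defensive.

(** * Truncated q-series *)

Section QSeries.
Local Open Scope ring_scope.
Variable R : numFieldType.
Implicit Types (p q r : {poly R}) (z w : R).

(** Working modulo X^k replaces power series: infinite products and their inverses never have to be
    formed. *)
Definition eqXn (k : nat) p q := 'X^k %| p - q.

Lemma eqXn_refl k p : eqXn k p p.
Proof. by rewrite /eqXn subrr dvdp0. Qed.

Lemma eqXn_sym k p q : eqXn k p q -> eqXn k q p.
Proof. by rewrite /eqXn -opprB dvdpNr. Qed.

Lemma eqXn_trans k p q r : eqXn k p q -> eqXn k q r -> eqXn k p r.
Proof.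
by rewrite /eqXn => pq qr; rewrite -(subrKA q) dvdp_add.
Qed.

Lemma eqXn_mul k p p' q q' : eqXn k p p' -> eqXn k q q' -> eqXn k (p * q) (p' * q').
Proof.
rewrite /eqXn => pp' qq'.
have -> : p * q - p' * q' = (p - p') * q + p' * (q - q') by ring.
by apply: dvdp_add; [apply: dvdp_mulr | apply: dvdp_mull].
Qed.

Lemma eqXn_leq j k p q : (j <= k)%N -> eqXn k p q -> eqXn j p q.
Proof. by move=> jk; apply: dvdp_trans; rewrite dvdp_exp2l. Qed.

Lemma eqXn_coef k p q i : (i < k)%N -> eqXn k p q -> p`_i = q`_i.
Proof.
move=> ik /dvdpP[c pq]; apply/eqP; rewrite -subr_eq0 -coefB pq.
by rewrite coefMXn ik.
Qed.

Lemma eqXn_monomial k (n : nat) p : (k <= n)%N -> eqXn k ('X^n * p) 0.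
Proof. by move=> kn; rewrite /eqXn subr0 dvdp_mulr // dvdp_exp2l. Qed.

(** The q-Pochhammer symbol (zq; q)_n with q = X. *)
Definition qpoch z (n : nat) : {poly R} := \prod_(1 <= k < n.+1) (1 - z *: 'X^k).

Lemma qpoch0 z : qpoch z 0 = 1.
Proof. by rewrite /qpoch big_geq. Qed.

Lemma qpochS z n : qpoch z n.+1 = qpoch z n * (1 - z *: 'X^(n.+1)).
Proof. by rewrite /qpoch big_nat_recr. Qed.

(** A factor of index at least k is 1 modulo X^k, so only the first k - 1 factors matter. *)
Lemma eqXn_qpoch k z m n : (k <= m.+1)%N -> (k <= n.+1)%N ->
  eqXn k (qpoch z m) (qpoch z n).
Proof.
have H j : (k <= (j + k.-1).+1)%N -> eqXn k (qpoch z (j + k.-1)) (qpoch z k.-1).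
  elim: j => [|j IHj] le_k; first exact: eqXn_refl.
  rewrite addSn qpochS; have {}IHj : eqXn k (qpoch z (j + k.-1)) (qpoch z k.-1) by apply: IHj; lia.
  rewrite -[X in eqXn _ _ X]mulr1; apply: eqXn_mul => //.
  rewrite /eqXn addrAC subrr sub0r dvdpNr -mul_polyC; apply: dvdp_mull; apply: dvdp_exp2l; lia.
move=> km kn.
have em : m = (m - k.-1 + k.-1)%N by lia.
have en : n = (n - k.-1 + k.-1)%N by lia.
rewrite em en; apply: eqXn_trans (H _ _) _; first by lia.
by apply: eqXn_sym; apply: H; lia.
Qed.

(* Counts partitions into at most [a] parts of size at most [K - a], with [z]
   marking the largest part (see [boxgf_bits]). *)
Fixpoint boxgf z (K a : nat) : {poly R} :=
  match K, a with
  | _, 0 => 1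
  | 0, _.+1 => 0
  | K'.+1, a'.+1 => z *: 'X^a * boxgf z K' a + boxgf z K' a'
  end.

Lemma boxgf0 z K : boxgf z K 0 = 1.
Proof. by case: K. Qed.

Lemma boxgfS z K a :
  boxgf z K.+1 a.+1 = z *: 'X^(a.+1) * boxgf z K a.+1 + boxgf z K a.
Proof. by []. Qed.

Lemma boxgf_small z K a : (K < a)%N -> boxgf z K a = 0.
Proof.
elim: K a => [|K IHK] [|a] //= lt_Ka.
by rewrite !IHK ?mulr0 ?addr0 //; lia.
Qed.

(** To this precision the bound on the largest part is not felt, and the series is 1 / (zq; q)_a.
    The recursion of [boxgf] expresses the error at (K+1, a+1) through those at (K, a+1) and (K, a),
    the former gaining a factor X^(a+1). *)
Lemma boxgf_qpoch z K a : eqXn (K.+1 - a) (boxgf z K a * qpoch z a) 1.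
Proof.
elim: K a => [|K IHK] [|a].
- by rewrite mul1r qpoch0 eqXn_refl.
- by rewrite /eqXn subSS sub0n expr0 dvd1p.
- by rewrite boxgf0 qpoch0 mulr1 eqXn_refl.
rewrite boxgfS /eqXn qpochS.
have -> : (z *: 'X^(a.+1) * boxgf z K a.+1 + boxgf z K a) *
    (qpoch z a * (1 - z *: 'X^(a.+1))) - 1
  = z *: ('X^(a.+1) * (boxgf z K a.+1 * (qpoch z a * (1 - z *: 'X^(a.+1))) - 1))
    + (1 - z *: 'X^(a.+1)) * (boxgf z K a * qpoch z a - 1).
  by rewrite -!mul_polyC; ring.
rewrite -qpochS; apply: dvdp_add.
  rewrite -mul_polyC; apply: dvdp_mull; apply: dvdp_trans (dvdp_mul (dvdpp _) (IHK a.+1)).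
  by rewrite -exprD; apply: dvdp_exp2l; lia.
by apply: dvdp_mull; rewrite subSS; apply: IHK.
Qed.

(** The q-binomial theorem: [boxgf 1 K a] is a Gaussian binomial coefficient. The induction splits
    off the factor k = 0 and replaces x by x X in the others. *)
Lemma boxgf_qbinomial (x y : {poly R}) K :
  \prod_(k < K) (y + x * 'X^k) =
  \sum_(a < K.+1) x ^+ a * y ^+ (K - a) * 'X^'C(a, 2) * boxgf 1 K a.
Proof.
elim: K x => [|K IHK] x.
  by rewrite big_ord0 big_ord_recl big_ord0 /= !expr0 !mulr1 addr0.
rewrite big_ord_recl expr0 mulr1.
under eq_bigr => k _ do rewrite lift0 exprS mulrA.
rewrite IHK mulrDl [in X in X + _ = _]big_ord_recl mulrDr !mulr_sumr.
rewrite [RHS]big_ord_recl.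
under [in RHS]eq_bigr => a _ do rewrite lift0 boxgfS mulrDr.
rewrite [in RHS]big_split [RHS]addrA.
congr (_ + _); last first.
  apply: eq_bigr => a _; rewrite subSS binS bin1 exprD exprMn [x ^+ a.+1]exprS; ring.
congr (_ + _).
  by rewrite /= !expr0 !boxgf0 !subn0 exprS; ring.
rewrite [RHS]big_ord_recr /= boxgf_small // !mulr0 addr0.
apply: eq_bigr => a _; rewrite /bump leq0n add1n binS bin1 subSS scale1r.
have -> : (K - a)%N = (K - a.+1).+1 by have := ltn_ord a; lia.
rewrite exprMn exprD [y ^+ _.+1]exprS; ring.
Qed.

(* The exponent j (j + 1) / 2 of the theta series at the signed index j = a - n. *)
Definition jexp (n a : nat) : nat :=
  if (n <= a)%N then 'C((a - n).+1, 2) else 'C(n - a, 2).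

Lemma bin2_double m : ('C(m, 2) * 2 = m * m.-1)%N.
Proof.
elim: m => // -[|m] // IHm.
by rewrite binS bin1 mulnDl IHm -mulnDr mulnC /= addn2.
Qed.

(** Completing the square: the exponents in the q-binomial sum share the part 'C(n, 2) + (n - 1) n,
    which [finite_jacobi] cancels. *)
Lemma jexpE n a : (0 < n)%N -> (a <= n + n)%N ->
  (n.-1 * (n + n - a) + 'C(a, 2) = 'C(n, 2) + n.-1 * n + jexp n a)%N.
Proof.
move=> n_gt0 le_a; apply/eqP; rewrite -(eqn_pmul2r (isT : 0 < 2)%N) !mulnDl.
rewrite /jexp; case: (leqP n a) => [le_na | lt_an]; rewrite !bin2_double; apply/eqP.
  have [j Ea] : exists j, a = (n + j)%N by exists (a - n)%N; lia.
  have [u En] : exists u, n = (j + u)%N by exists (n - j)%N; lia.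
  have -> : (n + n - a = u)%N by lia.
  have -> : (a - n = j)%N by lia.
  by rewrite {}Ea; case: n n_gt0 En {le_a le_na} => //= n _ En; rewrite addSn /=; nia.
have [j En] : exists j, n = (a + j)%N by exists (n - a)%N; lia.
have -> : (n + n - a = n + j)%N by lia.
have -> : (n - a = j)%N by lia.
have : (0 < j)%N by lia.
by rewrite {}En; case: j => // j _; rewrite addnS /=; case: a {le_a lt_an} => [|a] /=; nia.
Qed.

(* The q-binomial theorem at x = -w, y = X^(n-1): this homogeneous form avoids
   the negative powers of X in the usual substitution x = -w X^(1-n). *)
Lemma finite_jacobi w n : (0 < n)%N ->
  \prod_(j < n) ('X^j - w%:P) * qpoch w n =
  \sum_(a < (n + n).+1) (- w)%:P ^+ a * 'X^(jexp n a) * boxgf 1 (n + n) a.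
Proof.
move=> n_gt0; have := boxgf_qbinomial (- w)%:P 'X^(n.-1) (n + n).
rewrite big_split_ord /=.
(* Pulling X^i out of X^(n-1) - w X^i leaves X^(n-1-i) - w; in the second half, pulling X^(n-1) out
   of X^(n-1) - w X^(n+i) leaves 1 - w X^(i+1). *)
have -> : \prod_(i < n) ('X^(n.-1) + (- w)%:P * 'X^i : {poly R}) =
          'X^('C(n, 2)) * \prod_(j < n) ('X^j - w%:P).
  rewrite (reindex_inj rev_ord_inj) /= -bin2_sum big_mkord.
  rewrite (big_morph _ (exprD 'X) (expr0 _)) [X in X * _](reindex_inj rev_ord_inj) /=.
  rewrite -big_split; apply: eq_bigr => j _ /=.
  rewrite mulrBr -exprD polyCN mulNr [w%:P * _]mulrC.
  by congr ('X^_ - _); have := ltn_ord j; lia.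
have -> : \prod_(i < n) ('X^(n.-1) + (- w)%:P * 'X^(n + i) : {poly R}) =
          'X^(n.-1 * n) * qpoch w n.
  rewrite /qpoch big_add1 big_mkord /= exprM -[X in _ ^+ X * _](card_ord n) -prodr_const.
  rewrite -big_split; apply: eq_bigr => j _ /=.
  rewrite mulrBr mulr1 -scalerAr -exprD -mul_polyC polyCN mulNr.
  by congr (_ - _ * 'X^_); lia.
rewrite mulrACA -exprD => E; apply: (mulfI (x := 'X^('C(n, 2) + n.-1 * n))).
  by rewrite expf_neq0 // polyX_eq0.
rewrite E mulr_sumr; apply: eq_bigr => a _.
have key : 'X^(n.-1) ^+ (n + n - a) * 'X^('C(a, 2)) =
  'X^('C(n, 2) + n.-1 * n) * 'X^(jexp n a) :> {poly R}.
  by rewrite -exprM -!exprD jexpE // -ltnS.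
by rewrite -(mulrA (_ ^+ a)) key; ring.
Qed.

(** A small exponent forces a to be close to n, hence far from both ends of the range 0, ..., 2n. *)
Lemma jexp_ge n a : (n <= a + (jexp n a).+1)%N /\ (a <= n + jexp n a)%N.
Proof.
rewrite /jexp; case: (leqP n a) => [le_na | lt_an]; first by rewrite binS bin1; lia.
have -> : (n - a = (n - a.+1).+1)%N by lia.
by rewrite binS bin1; lia.
Qed.

(** The reflection is j -> -1 - j, which fixes j (j + 1) / 2. *)
Lemma jexp_sym n a : (a < n + n)%N -> jexp n (n + n - a.+1) = jexp n a.
Proof.
rewrite /jexp => lt_a; case: (leqP n a) => le_na; case: leqP => le' //; try lia.
  by congr 'C(_, _); lia.
by congr 'C(_, _); lia.
Qed.

(** For j = 0, ..., 4 the residues of j (j + 1) / 2 are 0, 1, 3, 1, 0. *)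
Lemma triangular_mod5 j : (2 <= 'C(j.+1, 2) %% 5)%N -> (j %% 5 = 2)%N.
Proof.
have /(congr1 (modn^~ 5)) := bin2_double j.+1.
rewrite -modnMm -[X in _ = X]modnMm -[j.+1]addn1 -[X in _ = ((X * _) %% _)%N]modnDml addn1 /=.
move: (ltn_pmod j (isT : 0 < 5)%N) (ltn_pmod 'C(j.+1, 2) (isT : 0 < 5)%N).
by case: (j %% 5)%N => [|[|[|[|[|r]]]]] //; case: ('C(_, 2) %% 5)%N => [|[|[|[|[|c]]]]].
Qed.

(** The class of 2 modulo 5 is fixed by j -> -1 - j, so both branches of [jexp] lead to it. *)
Lemma jexp_mod5 n a : (2 <= jexp n a %% 5)%N -> (a = n + 2 %[mod 5])%N.
Proof.
rewrite /jexp; case: (leqP n a) => [le_na | lt_an].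
  by move=> /triangular_mod5; lia.
have -> : (n - a = (n - a.+1).+1)%N by lia.
by move=> /triangular_mod5; lia.
Qed.

(* The terms of index a and 2n - 1 - a of the theta series have the same exponent,
   and cancel when that exponent is 2, 3 or 4 mod 5. *)
Lemma qpoch_triple_coef w M m : 5.-primitive_root w -> (2 <= M %% 5)%N -> (M <= m)%N ->
  (qpoch 1 m * qpoch w m * qpoch w^-1 m)`_M = 0.
Proof.
move=> w5 M5 le_Mm.
have wn0 : w != 0.
  apply/eqP => w0; have /eqP := prim_expr_order w5.
  by rewrite w0 expr0n eq_sym oner_eq0.
have w1 : 1 - w^-1 != 0.
  rewrite subr_eq0 eq_sym -[1]invr1 (inj_eq invr_inj) -[w]expr1 -(expr0 w).
  by rewrite (eq_prim_root_expr w5).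
(* With this n, every a of exponent at most M satisfies M + 1 <= a <= n + M, so its box series can
   be replaced by 1 / (q; q)_a modulo X^(M+1). *)
pose n := (M.+1 + M.+1)%N.
pose S := \sum_(a < (n + n).+1) (- w) ^+ a * (M == jexp n a)%:R.
have S0 : S = 0.
  (* The last index 2n has no partner under the reflection, but its exponent exceeds M. *)
  rewrite /S big_ord_recr /= [M == _]eqn_leq [X in _ && X]leqNgt.
  have [_ HT] := jexp_ge n (n + n).
  have -> : (M < jexp n (n + n))%N by rewrite /n in HT *; lia.
  rewrite andbF mulr0 addr0; set S' := (X in X = 0).
  apply/eqP; rewrite -eqNr; apply/eqP; rewrite /S' -sumrN (reindex_inj rev_ord_inj) /=.
  apply: eq_bigr => a _; rewrite jexp_sym // -mulNr.
  case: eqP => [MT | _]; rewrite ?mulr0 // !mulr1.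
  have a5 := jexp_mod5 (etrans (esym (congr1 (fun x => 2 <= x %% 5)%N MT)) M5).
  (* The signs differ because a and 2n - 1 - a have opposite parities; the powers of w agree because
     both indices are n + 2 modulo 5. *)
  rewrite -[- w]mulN1r !exprMn -mulNr -[- _ ^+ _]mulN1r -exprS; congr (_ * _).
    by rewrite -signr_odd -[RHS]signr_odd; congr (_ ^+ nat_of_bool _); have := ltn_ord a; lia.
  apply/eqP; rewrite (eq_prim_root_expr w5); apply/eqP.
  by have := ltn_ord a; lia.
have E := finite_jacobi w (isT : 0 < n)%N.
(* The factor j = 0 is constant and contributes 1 - w^-1, which is nonzero and can be divided out at
   the end. *)
have prodE : \prod_(j < n) ('X^j - w%:P) = ((- w) ^+ n * (1 - w^-1)) *: qpoch w^-1 n.-1.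
  rewrite -scalerA.
  have -> : (1 - w^-1) *: qpoch w^-1 n.-1 = \prod_(k < n) (1 - w^-1 *: 'X^k).
    rewrite -(big_mkord xpredT (fun k => 1 - w^-1 *: 'X^k)) big_ltn // expr0.
    by rewrite -mul_polyC polyCB -[w^-1 *: 1]mul_polyC mulr1.
  rewrite -[X in _ ^+ X](card_ord n) -mul_polyC rmorphXn -prodr_const -big_split /=.
  apply: eq_bigr => j _; rewrite polyCN -mul_polyC mulrBr mulr1 mulrA mulNr.
  by rewrite -polyCM mulfV // mulNr mul1r opprK addrC.
have coefE : (qpoch 1 M * (\prod_(j < n) ('X^j - w%:P) * qpoch w n))`_M = S.
  rewrite E mulr_sumr coef_sum; apply: eq_bigr => a _.
  rewrite -polyC_exp -mulrA mulrCA coefCM; congr (_ * _).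
  rewrite mulrCA mulrA; case: (leqP (jexp n a) M) => [leT | ltM]; last first.
    have -> : (M == jexp n a) = false by lia.
    rewrite -mulrA (eqXn_coef (k := M.+1) _ (eqXn_monomial _ _)) ?coef0 //.
  have [Ha1 Ha2] := jexp_ge n a.
  rewrite -mulrA (eqXn_coef (k := M.+1) (q := 'X^(jexp n a) * 1)) //.
    by rewrite mulr1 coefXn.
  apply: eqXn_mul; first exact: eqXn_refl.
  have H : eqXn M.+1 (boxgf (1 : R) (n + n) a * qpoch 1 a) 1.
    apply: eqXn_leq _ (boxgf_qpoch _ _ _).
    by move: (jexp n a) leT Ha1 Ha2 => T; rewrite /n; lia.
  rewrite mulrC; apply: eqXn_trans _ H; apply: eqXn_mul; first exact: eqXn_refl.
  by apply: eqXn_qpoch => //; move: (jexp n a) leT Ha1 Ha2 => T; rewrite /n; lia.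
move: coefE; rewrite S0 prodE -scalerAl -scalerAr coefZ => /eqP.
have cn0 : (- w) ^+ n * (1 - w^-1) != 0 by rewrite mulf_neq0 ?expf_neq0 ?oppr_eq0.
rewrite mulf_eq0 (negPf cn0) => /eqP E0; rewrite -[RHS]E0.
apply: (eqXn_coef (k := M.+1)) => //; rewrite [_ * qpoch w n]mulrC mulrA.
by do !apply: eqXn_mul; apply: eqXn_qpoch => //; rewrite /n /=; lia.
Qed.

Lemma prod_prim_root5 z (y : {poly R}) : 5.-primitive_root z ->
  \prod_(i < 5) (1 - z ^+ i *: y) = 1 - y ^+ 5.
Proof.
move=> z5; have z1 : z ^+ 5 = 1 := prim_expr_order z5.
have zn1 : z - 1 != 0.
  by rewrite subr_eq0 -[z]expr1 -(expr0 z) (eq_prim_root_expr z5).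
have zs : z ^+ 2 + z ^+ 3 = - 1 - (z + z ^+ 4).
  have /eqP : (z - 1) * (1 + z + z ^+ 2 + z ^+ 3 + z ^+ 4) = 0.
    by transitivity (z ^+ 5 - 1); [ring | rewrite z1 subrr].
  rewrite mulf_eq0 (negPf zn1) /= => /eqP zs; rewrite -[RHS]addr0 -zs; ring.
rewrite !big_ord_recl big_ord0 /= /bump /= !add1n expr0 expr1 scale1r mulr1.
rewrite -!mul_polyC !polyC_exp; set Z := z%:P.
have Z1 : Z ^+ 5 = 1 by rewrite -polyC_exp z1.
have Zs : Z ^+ 2 + Z ^+ 3 = - 1 - (Z + Z ^+ 4).
  by rewrite -!polyC_exp -!polyCD zs polyCB polyCN.
have Zp : (Z + Z ^+ 4) * (Z ^+ 2 + Z ^+ 3) = - 1.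
  transitivity (Z ^+ 3 + Z ^+ 4 + Z ^+ 5 * Z + Z ^+ 5 * Z ^+ 2); first by ring.
  rewrite Z1 !mul1r; transitivity (Z ^+ 2 + Z ^+ 3 + (Z + Z ^+ 4)); first by ring.
  by rewrite Zs; ring.
(* Pairing i with 5 - i gives two quadratics whose middle coefficients involve Z + Z^4 and Z^2 +
   Z^3, with sum -1 and product -1. *)
transitivity ((1 - y) * ((1 - (Z + Z ^+ 4) * y + Z ^+ 5 * y ^+ 2) *
              (1 - (Z ^+ 2 + Z ^+ 3) * y + Z ^+ 5 * y ^+ 2))); first by ring.
rewrite Z1 !mul1r.
transitivity ((1 - y) * (1 - ((Z + Z ^+ 4) + (Z ^+ 2 + Z ^+ 3)) * y +
   ((Z + Z ^+ 4) * (Z ^+ 2 + Z ^+ 3) + 2%:R) * y ^+ 2 -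
   ((Z + Z ^+ 4) + (Z ^+ 2 + Z ^+ 3)) * y ^+ 3 + y ^+ 4)); first by ring.
by rewrite Zp Zs; ring.
Qed.

Lemma prod_qpoch5 z n : 5.-primitive_root z ->
  \prod_(i < 5) qpoch (z ^+ i) n = qpoch 1 n \Po 'X^5.
Proof.
move=> z5; rewrite /qpoch exchange_big rmorph_prod /=; apply: eq_bigr => k _.
rewrite prod_prim_root5 // comp_polyB comp_polyC comp_polyZ scale1r.
by rewrite comp_Xn_poly exprAC.
Qed.

Lemma coef0_qpoch z n : (qpoch z n)`_0 = 1.
Proof.
have H : eqXn 1 (qpoch z n) (qpoch z 0) by exact: eqXn_qpoch.
by rewrite (eqXn_coef _ H) // qpoch0 coef1.
Qed.

(* The factor [qpoch 1 N \Po 'X^5] only shifts exponents by multiples of 5, so the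
   vanishing passes from the numerator to the quotient by induction on [M]. *)
Lemma boxgf_pair_coef z N K a K' a' M : 5.-primitive_root z ->
  (N <= a)%N -> (a + N <= K)%N -> (N <= a')%N -> (a' + N <= K')%N ->
  (M <= N)%N -> (2 <= M %% 5)%N ->
  (boxgf z K a * boxgf (z ^+ 4) K' a')`_M = 0.
Proof.
move=> z5 Na aK Na' aK' le_MN M5.
have zn0 : z != 0.
  apply/eqP => w0; have /eqP := prim_expr_order z5.
  by rewrite w0 expr0n eq_sym oner_eq0.
set F : {poly R} := boxgf z K a * _.
have box1 w K1 a1 : (N <= a1)%N -> (a1 + N <= K1)%N ->
    eqXn N.+1 (boxgf w K1 a1 * qpoch w N) 1.
  move=> Na1 aK1.
  have H : eqXn N.+1 (boxgf w K1 a1 * qpoch w a1) 1.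
    by apply: eqXn_leq _ (boxgf_qpoch _ _ _); lia.
  apply: eqXn_trans _ H; apply: eqXn_mul; first exact: eqXn_refl.
  by apply: eqXn_qpoch => //; lia.
(* Of the five products over the powers of z, the two boxes cancel those at z and z^4; the remaining
   ones, at 1, z^2 and z^3, form the triple product for w = z^2. *)
have FE : eqXn N.+1 (F * (qpoch 1 N \Po 'X^5))
    (qpoch 1 N * qpoch (z ^+ 2) N * qpoch (z ^+ 2)^-1 N).
  have -> : (z ^+ 2)^-1 = z ^+ 3.
    apply: (mulfI (expf_neq0 2 zn0)); rewrite mulfV ?expf_neq0 // -exprD.
    by rewrite (prim_expr_order z5).
  rewrite -(prod_qpoch5 _ z5) !big_ord_recl big_ord0 /= /bump /= !add1n expr0 expr1 mulr1.
  have -> : F * (qpoch 1 N * (qpoch z N * (qpoch (z ^+ 2) N * (qpoch (z ^+ 3) N *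
      qpoch (z ^+ 4) N)))) =
    (boxgf z K a * qpoch z N) * (boxgf (z ^+ 4) K' a' * qpoch (z ^+ 4) N) *
    (qpoch 1 N * qpoch (z ^+ 2) N * qpoch (z ^+ 3) N) by rewrite /F; ring.
  rewrite -[X in eqXn _ _ X]mul1r; apply: eqXn_mul; last exact: eqXn_refl.
  by rewrite -[1]mulr1; apply: eqXn_mul; apply: box1.
have z25 : 5.-primitive_root (z ^+ 2) by rewrite (prim_root_exp_coprime _ z5).
elim/ltn_ind: M le_MN M5 => M IHM le_MN M5.
have := eqXn_coef (le_MN : (M < N.+1)%N) FE.
rewrite qpoch_triple_coef // coefM big_ord_recr /= subnn coef_comp_poly_Xn //=.
rewrite div0n coef0_qpoch mulr1 big1 ?add0r // => i _.
rewrite coef_comp_poly_Xn //; case: ifP => [d5 | _]; last by rewrite mulr0.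
have lt_i := ltn_ord i.
by rewrite IHM ?mul0r //; lia.
Qed.
End QSeries.

(** * Equidistribution modulo 5 from sums at roots of unity *)

Section Equidist.
Local Open Scope ring_scope.

(** Roots of unity filter: summing z^(j (r x + 5 - m)) over j < 5 gives 5 or 0 according as r x is m
    modulo 5 or not. For j > 0 the power z^j is again primitive, so only j = 0 survives the sum over
    [l]. *)
Lemma equidistributed_mod5 (T : Type) (l : seq T) (r : T -> nat) (m : nat) :
  (forall z : algC, 5.-primitive_root z -> \sum_(x <- l) z ^+ r x = 0) ->
  (m < 5)%N -> (5 * count (fun x => r x %% 5 == m) l)%N = size l.
Proof.
move=> sum0 lt_m5; have [z z5] := C_prim_root_exists (isT : (0 < 5)%N).
have z1 := prim_expr_order z5.
have geom k : \sum_(j < 5) z ^+ j ^+ k = (if k %% 5 == 0 then 5 else 0)%N%:R :> algC.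
  under eq_bigr => j _ do rewrite exprAC.
  have uE : (z ^+ k == 1) = (k %% 5 == 0)%N.
    by rewrite -(expr0 z) (eq_prim_root_expr z5) /= mod0n.
  case: eqP uE => [-> <-|/eqP u1 <-].
    by under eq_bigr => j _ do rewrite expr1n; rewrite sumr_const card_ord.
  have /eqP : (z ^+ k - 1) * \sum_(j < 5) (z ^+ k) ^+ j = 0.
    by rewrite -subrX1 exprAC z1 expr1n subrr.
  by rewrite mulf_eq0 subr_eq0 (negPf u1) => /eqP.
have E : \sum_(j < 5) \sum_(x <- l) z ^+ j ^+ (r x + (5 - m)) = (size l)%:R :> algC.
  rewrite big_ord_recl [X in _ + X]big1 => [|j _].
    under eq_bigr => x _ do rewrite /= expr0 expr1n.
    by rewrite addr0 big_const_seq count_predT iter_addr_0.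
  have zj : 5.-primitive_root (z ^+ lift ord0 j).
    by rewrite (prim_root_exp_coprime _ z5); case: j => [[|[|[|[|]]]]].
  under eq_bigr => x _ do rewrite exprD.
  by rewrite -mulr_suml sum0 ?mul0r.
apply/eqP; rewrite -(eqr_nat algC) -E exchange_big /=.
under eq_bigr => x _ do rewrite geom.
rewrite -natr_sum eqr_nat -sum1_count big_distrr /= big_mkcond /=; apply/eqP.
by apply: eq_bigr => x _; rewrite muln1; do 2!case: eqP => //; lia.
Qed.
End Equidist.

(** * Boundary words of partitions *)

Section BitWords.

(** The enumeration follows the recursion of [boxgf], which is thereby its generating function. *)
Fixpoint bits (K a : nat) : seq bitseq :=
  match K, a with
  | 0, 0 => [:: [::]]
  | 0, _.+1 => [::]
  | K'.+1, 0 => map (cons false) (bits K' 0)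
  | K'.+1, a'.+1 => map (cons false) (bits K' a) ++ map (cons true) (bits K' a')
  end.

Lemma mem_bits K a s : (s \in bits K a) = (size s == K) && (count id s == a).
Proof.
have mem_cons (b c : bool) (t : bitseq) (l : seq bitseq) :
    (b :: t \in map (cons c) l) = (b == c) && (t \in l).
  apply/mapP/andP => [[u ul [-> ->]]|[/eqP-> tl]]; first by rewrite eqxx.
  by exists t.
have mem_nil (c : bool) (l : seq bitseq) : ([::] \in map (cons c) l) = false.
  by apply/negP => /mapP[].
elim: K a s => [|K IHK] [|a] [|b s] //=; rewrite ?mem_cat ?mem_cons ?mem_nil ?IHK //.
by case: b; rewrite /= ?eqSS ?andbF.
by case: b => /=; rewrite ?orbF ?eqSS.
Qed.

Lemma bits_uniq K a : uniq (bits K a).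
Proof.
have cons_inj (b : bool) : injective (cons b) by move=> s t [].
elim: K a => [|K IHK] [|a] //=; rewrite ?cat_uniq ?map_inj_uniq ?IHK //= andbT.
by apply/hasP => -[s /mapP[t _ ->] /mapP[u _]].
Qed.

(* [invs s] is the size of the partition whose boundary path is [s]; [gaps s] is
   its largest part, i.e. the number of parts of its conjugate. *)
Fixpoint invs (s : bitseq) : nat :=
  if s is b :: s' then (if b then 0 else count id s') + invs s' else 0.

Fixpoint gaps (s : bitseq) : nat :=
  if s is b :: s' then (~~ b && has id s') + gaps s' else 0.

Fixpoint evens (s : bitseq) : bitseq :=
  if s is b :: s' then b :: odds s' else [::]
with odds (s : bitseq) : bitseq :=
  if s is b :: s' then evens s' else [::].

Lemma boxgf_bits (R : numFieldType) (z : R) K a :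
  boxgf z K a = (\sum_(s <- bits K a) z ^+ gaps s *: 'X^(invs s))%R.
Proof.
elim: K a => [|K IHK] [|a]; rewrite ?big_seq1 ?big_nil ?expr0 ?scale1r //.
  rewrite boxgf0 -(boxgf0 z K) IHK big_map; apply: eq_big_seq => s.
  by rewrite mem_bits => /andP[_ /eqP s0] /=; rewrite has_count s0.
rewrite boxgfS !IHK big_cat !big_map /= mulr_sumr; congr (_ + _)%R.
apply: eq_big_seq => s; rewrite mem_bits => /andP[_ /eqP sa].
by rewrite has_count sa /= !exprD expr1 -scalerAl -scalerAr scalerA.
Qed.

(** [invs s] counts pairs [false] before [true] and the binomial counts pairs of [true], so the left
    side is the sum of the positions of the letters [true]. Position k of a half word is position 2k
    or 2k + 1 of [s]. *)
Lemma invs_evens_odds s :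
  invs s + 'C(count id s, 2) =
  2 * (invs (evens s) + 'C(count id (evens s), 2) +
       (invs (odds s) + 'C(count id (odds s), 2))) + count id (odds s)
  /\ count id s = count id (evens s) + count id (odds s).
Proof.
elim: s => // -[] s [IHs IHc] /=; rewrite ?add1n ?add0n ?binS ?bin1; lia.
Qed.

Lemma size_evens_odds s :
  size (evens s) = uphalf (size s) /\ size (odds s) = (size s)./2.
Proof. by elim: s => // b s [IHe IHo] /=; rewrite IHe IHo. Qed.

Lemma nth_evens_odds s k :
  nth false (evens s) k = nth false s k.*2 /\
  nth false (odds s) k = nth false s k.*2.+1.
Proof.
elim: s k => [|b s IHs] k /=; first by rewrite !nth_nil.
by split; [case: k => // k /=; have [_ ->] := IHs k | have [-> _] := IHs k].
Qed.

Lemma evens_odds_inj s t : evens s = evens t -> odds s = odds t -> s = t.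
Proof.
by elim: s t => [|b s IHs] [|c t] //= [-> eo] ee; rewrite (IHs t).
Qed.

Lemma evens_odds_surj s0 s1 : size s0 = size s1 ->
  exists s, evens s = s0 /\ odds s = s1.
Proof.
elim: s0 s1 => [|b s0 IHs] [|c s1] //= => [_|[/IHs[s [<- <-]]]]; first by exists [::].
by exists [:: b, c & s].
Qed.

Lemma gapsE s :
  gaps s = count (fun k => ~~ nth false s k && has id (drop k.+1 s)) (iota 0 (size s)).
Proof.
elim: s => //= b s ->; rewrite drop0 -[1]addn0 iotaDl count_map.
by congr (_ + _); apply: eq_count.
Qed.

(** For x = 0, the parts of the partition in nondecreasing order, zero parts included. *)
Fixpoint heights (x : nat) (s : bitseq) : seq nat :=
  if s is b :: s' then if b then x :: heights x s' else heights x.+1 s' else [::].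

Lemma size_heights x s : size (heights x s) = count id s.
Proof. by elim: s x => // -[] s IHs x /=; rewrite IHs. Qed.

Lemma heights_bound x s y :
  y \in heights x s -> x <= y <= x + count negb s.
Proof.
elim: s x => // -[] s IHs x /=; last by move/IHs; lia.
by rewrite inE => /orP[/eqP-> | /IHs]; lia.
Qed.

Lemma heights_sorted x s : sorted leq (heights x s).
Proof.
elim: s x => // -[] s IHs x //=; rewrite (path_sortedE leq_trans) IHs andbT.
by apply/allP => y /heights_bound/andP[].
Qed.

Lemma sumn_heights x s : sumn (heights x s) = x * count id s + invs s.
Proof. by elim: s x => [|[] s IHs] x /=; rewrite ?IHs; nia. Qed.

Lemma heights_inj x s t : size s = size t -> heights x s = heights x t -> s = t.
Proof.
have absurd y u v : y :: u <> heights y.+1 v.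
  by move=> E; have := heights_bound (x := y.+1) (s := v) (y := y);
     rewrite -E mem_head ltnn => /(_ isT).
elim: s x t => [|[] s IHs] x [|[] t] //= [szE].
- by case=> /IHs->.
- by move/absurd.
- by move/esym/absurd.
- by move/IHs->.
Qed.

Lemma heights_surj b x (l : seq nat) :
  sorted leq l -> all (fun y => x <= y <= x + b) l ->
  exists s, [/\ size s = size l + b, count id s = size l & heights x s = l].
Proof.
elim: b x l => [|b IHb] x; elim=> [|y l IHl] //= l_sorted.
- by exists [::].
- move=> /andP[xy /IHl[|s [s1 s2 s3]]]; first exact: path_sorted l_sorted.
  by exists (true :: s); rewrite /= s1 s2 s3; split=> //; congr (_ :: _); lia.
- have [s [s1 s2 s3]] := IHb x.+1 [::] isT isT.
  by exists (false :: s); rewrite /= s1 s2 s3.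
case: (eqVneq y x) => [-> /andP[_ /IHl[|s [s1 s2 s3]]] | yx l_all].
- exact: path_sorted l_sorted.
- by exists (true :: s); rewrite /= s1 s2 s3; split.
have [||s [s1 s2 s3]] := IHb x.+1 (y :: l) => //; last first.
  by exists (false :: s); rewrite /= s1 s2 s3 addnS; split.
move: l_sorted; rewrite (path_sortedE leq_trans) => /andP[/allP yl _].
move: l_all => /andP[xy /allP l_all] /=; apply/andP; split; first by lia.
by apply/allP => u ul; have := yl u ul; have := l_all u ul; lia.
Qed.

(** The position of the i-th [true] is the number of letters before it: i letters [true], and as
    many [false] as its height exceeds x. *)
Lemma nth_heights x s k : size s > k ->
  reflect (exists2 i, i < count id s & nth 0 (heights x s) i + i = x + k) (nth false s k).
Proof.
elim: s x k => // -[] s IHs x [|k] /= lt_k.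
- by apply: ReflectT; exists 0; rewrite ?addn0.
- apply: (iffP (IHs x k lt_k)) => -[[|i] lt_i E].
  + by exists 1 => //=; lia.
  + by exists i.+2 => //=; move: E => /=; lia.
  + by move: E => /=; lia.
  + by exists i => //; move: E => /=; lia.
- apply: ReflectF => -[i lt_i E].
  have : nth 0 (heights x.+1 s) i \in heights x.+1 s by rewrite mem_nth // size_heights.
  by move/heights_bound; lia.
- by apply: (iffP (IHs x.+1 k lt_k)) => -[i lt_i E]; exists i; lia.
Qed.

End BitWords.

(** * Partitions of n as balanced words *)

Section PartitionWords.

Lemma sumn_ge (l : seq nat) x : x \in l -> x <= sumn l.
Proof.
by elim: l => // y l IHl; rewrite inE => /orP[/eqP-> | /IHl] /=; lia.
Qed.

Lemma sorted_geq_filter_pos (l : seq nat) : sorted geq l ->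
  l = [seq x <- l | 0 < x] ++ nseq (size l - size [seq x <- l | 0 < x]) 0.
Proof.
elim: l => // x l IHl; rewrite /= (path_sortedE (rev_trans leq_trans)).
move=> /andP[x_max l_sorted]; case: posnP => [x0 | x_gt0] /=; last first.
  by rewrite subSS -IHl.
have l0 : all (pred1 0) l.
  by apply: sub_all x_max => y /=; rewrite x0 leqn0.
have -> : [seq x <- l | 0 < x] = [::].
  apply/eqP; rewrite -(negbK (_ == _)) -has_filter -all_predC.
  by apply: sub_all l0 => y /= /eqP->.
by rewrite x0 /= ?subn0; congr (_ :: _); apply/all_pred1P.
Qed.

Definition ptn_word (s : bitseq) : seq nat := [seq x <- rev (heights 0 s) | 0 < x].

Lemma rev_heights s :
  rev (heights 0 s) = ptn_word s ++ nseq (count id s - size (ptn_word s)) 0.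
Proof.
rewrite -(size_heights 0) -size_rev; apply: sorted_geq_filter_pos.
by rewrite rev_sorted heights_sorted.
Qed.

Lemma nth_ptn_word s j : nth 0 (ptn_word s) j = nth 0 (rev (heights 0 s)) j.
Proof.
rewrite rev_heights nth_cat; case: ltnP => // le_j.
by rewrite nth_default // nth_nseq if_same.
Qed.

Lemma sumn_ptn_word s : sumn (ptn_word s) = invs s.
Proof.
have := sumn_heights 0 s; rewrite mul0n add0n -sumn_rev rev_heights sumn_cat.
by rewrite sumn_nseq mul0n addn0.
Qed.

Lemma ptn_word_sorted s : sorted geq (ptn_word s).
Proof.
apply: sorted_filter; first exact: (rev_trans leq_trans).
by rewrite rev_sorted heights_sorted.
Qed.

Lemma size_le_sumn (l : seq nat) : all (fun x => 0 < x) l -> size l <= sumn l.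
Proof. by elim: l => //= x l IHl /andP[x0 /IHl]; lia. Qed.

Lemma filter_pos_mkseq (l : seq nat) n : all (fun x => 0 < x) l -> size l <= n ->
  mkseq (nth 0 l) n = l ++ nseq (n - size l) 0.
Proof.
move=> l_pos le_n; apply: (@eq_from_nth _ 0) => [|k].
  by rewrite size_mkseq size_cat size_nseq subnKC.
rewrite size_mkseq => lt_k; rewrite nth_mkseq // nth_cat; case: ltnP => // le_k.
by rewrite nth_default // nth_nseq if_same.
Qed.

Lemma sorted_geq_mkseq (l : seq nat) n : sorted geq l -> sorted geq (mkseq (nth 0 l) n).
Proof.
move=> l_sorted; apply/(sortedP 0) => k; rewrite size_mkseq => lt_k.
rewrite !nth_mkseq ?(ltnW lt_k) //.
case: (ltnP k.+1 (size l)) => [lt_kl | le_lk]; first by apply/(sortedP 0).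
by rewrite [nth _ _ k.+1]nth_default //=.
Qed.

Lemma filter_pos_nseq0 n : [seq x <- nseq n 0 | 0 < x] = [::].
Proof. by elim: n. Qed.

Lemma fseq_inj n : injective (@fseq n).
Proof.
move=> f g /eq_in_map E; apply/ffunP => i; apply: val_inj.
by apply: E; rewrite mem_enum.
Qed.

Lemma size_fseq n (f : {ffun 'I_n -> 'I_n.+1}) : size (fseq f) = n.
Proof. by rewrite size_map size_enum_ord. Qed.

(** A partition of n <= L has at most L parts, each at most L, and so fits in the box. *)
Lemma card_ptn_words n L (P : seq nat -> bool) : n <= L ->
  card_ptn n P = count (fun s => (invs s == n) && P (ptn_word s)) (bits (L + L) L).
Proof.
move=> le_nL.
pose phi (s : bitseq) : {ffun 'I_n -> 'I_n.+1} :=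
  [ffun i : 'I_n => inord (nth 0 (ptn_word s) i)].
have ptn_pos s : all (fun x => 0 < x) (ptn_word s) by apply: filter_all.
have fseq_phi s : invs s = n ->
    fseq (phi s) = ptn_word s ++ nseq (n - size (ptn_word s)) 0.
  move=> sn; rewrite -filter_pos_mkseq //; last first.
    by rewrite -sn -sumn_ptn_word size_le_sumn.
  rewrite /mkseq -val_enum_ord -map_comp; apply: eq_map => i /=.
  rewrite ffunE inordK // ltnS -[X in _ <= X]sn -sumn_ptn_word.
  case: (ltnP i (size (ptn_word s))) => [lt_i | le_i]; last by rewrite nth_default.
  by apply: sumn_ge; rewrite mem_nth.
have ptn_phi s : invs s = n -> ptn_of (phi s) = ptn_word s.
  move=> sn; rewrite /ptn_of fseq_phi // filter_cat (all_filterP (ptn_pos s)).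
  by rewrite filter_pos_nseq0 cats0.
rewrite /card_ptn cardE -size_filter -(size_map phi); apply: perm_size; apply: uniq_perm.
- exact: enum_uniq.
- rewrite map_inj_in_uniq ?filter_uniq ?bits_uniq // => s t.
  rewrite !mem_filter !mem_bits => /andP[/andP[/eqP sn _] /andP[/eqP s1 /eqP s2]].
  move=> /andP[/andP[/eqP tn _] /andP[/eqP t1 /eqP t2]] /(congr1 (@ptn_of n)).
  rewrite !ptn_phi // => E; apply: (@heights_inj 0); first by rewrite s1.
  by apply: (can_inj revK); rewrite !rev_heights E s2 t2.
move=> f; rewrite mem_enum inE; apply/idP/mapP => [/andP[/andP[f_sorted /eqP f_sum] Pf]|].
  pose l := ptn_of f; have fE := sorted_geq_filter_pos f_sorted.
  rewrite size_fseq -/(ptn_of f) -/l in fE.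
  have l_pos : all (fun x => 0 < x) l by apply: filter_all.
  have l_sum : sumn l = n.
    by rewrite -f_sum fE sumn_cat sumn_nseq mul0n addn0.
  have l_size : size l <= n by rewrite -l_sum size_le_sumn.
  have l_sorted : sorted geq l.
    by apply: sorted_filter => //; exact: (rev_trans leq_trans).
  (* Zero parts are added up to exactly L heights, so that the word has L letters [true]. *)
  have [||s [s1 s2 s3]] := @heights_surj L 0 (nseq (L - size l) 0 ++ rev l).
  - rewrite -rev_sorted rev_cat revK rev_nseq.
    have -> : l ++ nseq (L - size l) 0 = mkseq (nth 0 l) L.
      by rewrite filter_pos_mkseq //; lia.
    exact: sorted_geq_mkseq.
  - rewrite all_cat all_nseq leqnn leq0n orbT /= all_rev; apply/allP => x /sumn_ge.
    by rewrite l_sum; lia.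
  rewrite size_cat size_nseq size_rev subnK in s1 s2; last by lia.
  have sl : ptn_word s = l.
    rewrite /ptn_word s3 rev_cat revK rev_nseq filter_cat.
    by rewrite (all_filterP l_pos) filter_pos_nseq0 cats0.
  have sn : invs s = n by rewrite -sumn_ptn_word sl.
  exists s; last by apply: fseq_inj; rewrite fseq_phi // sl.
  by rewrite mem_filter mem_bits sn sl s1 s2 !eqxx Pf.
case=> s; rewrite mem_filter => /andP[/andP[/eqP sn Ps] _] ->.
rewrite ptn_phi // Ps andbT fseq_phi // sumn_cat sumn_nseq mul0n addn0 sumn_ptn_word sn eqxx andbT.
rewrite -filter_pos_mkseq //; last by rewrite -[X in _ <= X]sn -sumn_ptn_word size_le_sumn.
exact: sorted_geq_mkseq (ptn_word_sorted s).
Qed.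
End PartitionWords.

(** * Quotient, Stanley rank and words *)

Section QuotientWords.

Lemma inSP l (x : int) :
  reflect (exists2 j, 0 < j & ((lam l j)%:Z - j%:Z = x)%R) (inS l x).
Proof.
apply: (iffP hasP) => [[j]|[j j_gt0 E]].
  by rewrite mem_iota => /andP[j_gt0 _] /eqP; exists j.
exists j; last exact/eqP.
rewrite mem_iota j_gt0 add1n ltnS /=; case: (leqP j (size l)) => [|lt_j]; first by lia.
by move: E; rewrite /lam nth_default; lia.
Qed.

Lemma inS_lt l (x : int) : inS l x -> (x < (sumn l)%:Z)%R.
Proof.
move=> /inSP[j j_gt0 <-].
have : lam l j <= sumn l; last by lia.
rewrite /lam; case: (ltnP j.-1 (size l)) => [lt_j | le_j]; last by rewrite nth_default.
exact: sumn_ge (mem_nth 0 lt_j).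
Qed.

Lemma inS_low l (x : int) : (x < - (size l)%:Z)%R -> inS l x.
Proof.
move=> lt_x; apply/inSP; exists `|x|%N; first by lia.
by rewrite /lam nth_default; lia.
Qed.

(** The part lambda_j is the height of the [true] letter of index L - j, whose position is lambda_j
    + L - j. Indices j > L give integers below -L, left of the word. *)
Lemma inS_word L s k : s \in bits (L + L) L ->
  inS (ptn_word s) (k%:Z - L%:Z)%R = nth false s k.
Proof.
rewrite mem_bits => /andP[/eqP s1 /eqP s2].
pose h i : nat := nth 0 (heights 0 s) i.
have lamE j : 0 < j -> lam (ptn_word s) j = if j <= L then h (L - j) else 0.
  move=> j_gt0; rewrite /lam nth_ptn_word; case: leqP => le_j; last first.
    by rewrite nth_default // size_rev size_heights s2; lia.
  by rewrite nth_rev size_heights s2 ?prednK.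
case: (ltnP k (size s)) => [lt_k | le_k].
  apply/inSP/(nth_heights 0 lt_k) => -[].
    move=> j j_gt0; rewrite lamE //; case: leqP => le_j E; last by lia.
    by exists (L - j); rewrite ?s2 -/(h _); lia.
  move=> i; rewrite s2 -/(h i) add0n => lt_i E; exists (L - i); first by lia.
  by rewrite lamE ?leq_subr ?subKn; lia.
rewrite [RHS]nth_default //; apply/negP => /inSP[j j_gt0].
rewrite lamE //; case: leqP => le_j E; last by lia.
have : h (L - j) \in heights 0 s by rewrite mem_nth // size_heights s2; lia.
move/heights_bound; have := count_predC id s; rewrite s1 s2 => /addnI.
by rewrite (eq_count (a2 := negb)) // => ->; lia.
Qed.

Lemma size_ptn_word s : size (ptn_word s) <= count id s.
Proof. by rewrite size_filter (leq_trans (count_size _ _)) // size_rev size_heights. Qed.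

Lemma mem_window B (x : int) : (x \in window B) = (- B%:Z <= x <= B%:Z)%R.
Proof.
apply/mapP/idP => [[z]|le_x]; first by rewrite mem_iota; lia.
by exists `|(x + B%:Z)%R|%N; rewrite ?mem_iota; lia.
Qed.

Lemma window_uniq B : uniq (window B).
Proof. by rewrite map_inj_uniq ?iota_uniq // => i j; lia. Qed.

(* The gaps of S_c below an element of S_c lie in the window, and become the
   [false] letters of the half word preceding a [true] letter. *)
Lemma nu_quot_parts M s c : s \in bits (M.*2 + M.*2) M.*2 -> c < 2 ->
  nu (quot_parts (ptn_word s) c) = gaps (if c == 0 then evens s else odds s).
Proof.
move=> s_bits lt_c2; set t := (if _ then _ else _).
have t_size : size t = M.*2.
  move: s_bits; rewrite mem_bits => /andP[/eqP s1 _].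
  have [E0 E1] := size_evens_odds s.
  by rewrite /t; case: ifP => _; rewrite ?E0 ?E1 s1 addnn ?uphalf_double ?doubleK.
have s_count : count id s = M.*2 by move: s_bits; rewrite mem_bits => /andP[_ /eqP].
(* Here L = 2 M, so 2 (k - M) + c = (2 k + c) - L is the integer attached to letter 2 k + c of
   [s]. *)
have inSc_word k : inSc (ptn_word s) c (k%:Z - M%:Z)%R = nth false t k.
  rewrite /inSc -[nth false t k](_ : nth false s (k.*2 + c) = _).
    by rewrite -(inS_word _ s_bits); congr inS; lia.
  have [E0 E1] := nth_evens_odds s k.
  by rewrite /t; case: c lt_c2 {t t_size} => [|[|]] // _; rewrite ?E0 ?E1 ?addn0 ?addn1.
have notin_ge x : ~~ inSc (ptn_word s) c x -> (- M%:Z <= x)%R.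
  apply: contraR => lt_x; apply: inS_low.
  by have := size_ptn_word s; lia.
rewrite gapsE /nu /quot_parts; set B := (_ + _).
have memW x := mem_window B x; have := window_uniq B; move: (window B) memW => W memW W_uniq.
rewrite count_map count_filter -[count _ W]size_filter -[count _ (iota _ _)]size_filter.
rewrite -[RHS](size_map (fun k : nat => (k%:Z - M%:Z)%R)); apply: perm_size.
apply: uniq_perm; first by rewrite filter_uniq.
  by rewrite map_inj_uniq ?filter_uniq ?iota_uniq // => i j; lia.
move=> g; rewrite mem_filter /= -has_count.
apply/andP/mapP => [[/andP[/hasP[x _ /andP[Sx lt_gx]] Sg] _]|[k]].
  have ge_g := notin_ge _ Sg.
  have Eg : g = (`|(g + M%:Z)%R|%N%:Z - M%:Z)%R by lia.
  have Ex : x = (`|(x + M%:Z)%R|%N%:Z - M%:Z)%R by lia.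
  move: Sg Sx lt_gx; rewrite {}Eg {}Ex; move: `|(g + _)%R|%N `|(x + _)%R|%N => k k'.
  rewrite !inSc_word => tk tk' lt_kk'; exists k => //.
  have lt_k' : k' < size t by case: ltnP tk' => // ?; rewrite nth_default.
  rewrite mem_filter tk mem_iota /=; apply/andP; split; last by lia.
  apply/(has_nthP false); exists (k' - k.+1); first by rewrite size_drop; lia.
  by rewrite nth_drop subnKC; lia.
rewrite mem_filter mem_iota => /andP[/andP[tk /(has_nthP false)[i]]].
rewrite size_drop nth_drop => lt_i ti lt_k ->.
have Sk : ~~ inSc (ptn_word s) c (k%:Z - M%:Z)%R by rewrite inSc_word.
have Si : inSc (ptn_word s) c ((k.+1 + i)%:Z - M%:Z)%R by rewrite inSc_word.
have lt_B := inS_lt Si.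
have ge_B : (- (size (ptn_word s))%:Z <= 2 * (k%:Z - M%:Z) + c%:Z)%R.
  by rewrite leNgt; apply: contra Sk; apply: inS_low.
split; last by rewrite memW /B; lia.
apply/andP; split=> //; apply/hasP; exists ((k.+1 + i)%:Z - M%:Z)%R.
  by rewrite memW /B; lia.
by rewrite Si; lia.
Qed.

(** Columns beyond the largest part are empty, hence even, so the range extends to the box width. *)
Lemma conjp_odd l W : sorted geq l -> head 0 l <= W ->
  nodd (conjp l) = count (fun j => odd (count (fun x => j < x) l)) (iota 0 W).
Proof.
move=> l_sorted le_W; rewrite /nodd /conjp count_map -(subnKC le_W) iotaD count_cat.
rewrite [X in _ = _ + X](_ : _ = 0) ?addn0 //; apply/eqP; rewrite -leqn0 leqNgt -has_count.
apply/hasPn => j; rewrite mem_iota add0n => /andP[le_j _].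
rewrite (_ : count _ l = 0) //; apply/eqP; rewrite -leqn0 leqNgt -has_count.
case: l l_sorted le_j {le_W} => //= x l; rewrite (path_sortedE (rev_trans leq_trans)).
move=> /andP[/allP x_max _] le_j; rewrite negb_or -leqNgt le_j /=.
by apply/hasPn => y /x_max /=; lia.
Qed.

Fixpoint odd_trues (s : bitseq) : nat :=
  if s is b :: s' then (b && odd (count negb s')) + odd_trues s' else 0.

Fixpoint odd_falses (s : bitseq) : nat :=
  if s is b :: s' then (~~ b && odd (count id s')) + odd_falses s' else 0.

(** The height of a [true] letter and the number of [false] letters after it add up to an even
    number, so their parities agree. *)
Lemma nodd_heights x s :
  ~~ odd (x + count negb s) -> count odd (heights x s) = odd_trues s.
Proof.
elim: s x => //= -[] s IHs x /= even_x.
  by rewrite IHs; [congr (nat_of_bool _ + _); move: even_x; rewrite add0n oddD; do 2!case: odd | ].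
by rewrite IHs // -[x.+1]addn1 -addnA.
Qed.

(** Columns correspond to letters [false]; the length of a column is the number of [true] letters
    after it. *)
Lemma nodd_conj_heights x s :
  count (fun j => odd (count (fun y => j < y) (heights x s))) (iota x (count negb s))
  = odd_falses s.
Proof.
elim: s x => //= -[] s IHs x /=.
  rewrite -(IHs x); apply: eq_in_count => j; rewrite mem_iota => /andP[le_xj _].
  by rewrite ltnNge le_xj.
rewrite IHs; congr (nat_of_bool (odd _) + _).
rewrite -(size_heights x.+1); apply/eqP; rewrite -all_count.
by apply/allP => y /heights_bound /andP[].
Qed.

Lemma srank_word L s : ~~ odd L -> s \in bits (L + L) L ->
  srank (ptn_word s) = ((odd_trues s)%:Z - (odd_falses s)%:Z)%R.
Proof.
move=> even_L; rewrite mem_bits => /andP[/eqP s1 /eqP s2].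
have s3 : count negb s = L.
  by have := count_predC id s; rewrite s1 s2 => /addnI <-; apply: eq_count.
have count_pos (a : pred nat) : (forall x, a x -> 0 < x) ->
    count a (ptn_word s) = count a (heights 0 s).
  move=> a_pos; rewrite count_filter count_rev; apply: eq_count => x /=.
  by apply: andb_idr => /a_pos.
rewrite /srank; congr (_%:Z - _%:Z)%R.
  rewrite /nodd count_pos; last by case.
  by rewrite nodd_heights // s3.
rewrite (conjp_odd (W := L)) ?ptn_word_sorted //; last first.
  have : {subset ptn_word s <= heights 0 s}.
    by move=> x; rewrite mem_filter mem_rev => /andP[].
  case: (ptn_word s) => // x l sub; have /heights_bound := sub x (mem_head x l).
  by rewrite s3 => /andP[].
rewrite -{1}s3 -(nodd_conj_heights 0); apply: eq_count => j.
by congr odd; apply: count_pos => x; apply: leq_ltn_trans.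
Qed.

(* Found by tracking both sides when a letter is prepended; for a balanced word
   it gives [srank = |pi| + (count (odds s) - count (evens s)) / 2] modulo 4. *)
Lemma odd_trues_falses_mod8 s :
  exists t : int,
  (2 * ((odd_trues s)%:Z - (odd_falses s)%:Z - (invs s)%:Z)
   + 4 * (count negb s * uphalf (count id s))%N%:Z + (odd (count id s) : nat)%:Z
   = (-1) ^+ odd (size s) * ((count id (odds s))%:Z - (count id (evens s))%:Z) + 8 * t)%R.
Proof.
elim: s => [|b s [t IHs]]; first by exists 0%R.
have szE : size s = count negb s + count id s.
  have := count_predC id s; rewrite (eq_count (a2 := negb) (a1 := predC id)) //; lia.
move: IHs; rewrite /= {}szE oddD.
have H := odd_double_half (count negb s); have H0 := odd_double_half (count id s).
move: H H0.
move: (count negb s) (count id s) (count id (odds s)) (count id (evens s)) => x y o e.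
move: (odd_trues s) (odd_falses s) (invs s) => T F I.
move: (uphalf_half y); move: (x./2) (y./2) => u v yE H H0 IHs.
case: b => /=.
  (* Prepending [true] raises [uphalf y] only for even y; the term 4 x this adds is what changes the
     multiple of 8. Prepending [false] changes neither side. *)
  exists (t + (~~ odd y)%:R * (u%:Z + (odd x : nat)%:Z))%R.
  move: H H0 IHs; case: (odd x); case: (odd y) => /=; nia.
exists t; move: H H0 IHs; case: (odd x); case: (odd y) => /=; nia.
Qed.

End QuotientWords.

(** * Fibres over the number of [true] letters in the even word *)

Section Fibres.
Variables (n : nat).
Let p := 5 * n + 4.
(** The side L = 4 p leaves room: in [quot_size_bounds], e and L - e are at least p while N is at
    most p. *)
Let M := p.*2.
Let L := M.*2.

(** The coefficient 4 replaces -1 modulo 5 and keeps the rank a natural number. *)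
Definition rank5 (s : bitseq) : nat := gaps (evens s) + 4 * gaps (odds s).

Lemma count_evens_odds s e : s \in bits (L + L) L -> count id (evens s) = e ->
  count id (odds s) = L - e /\ e <= L.
Proof.
rewrite mem_bits => /andP[_ /eqP sL] <-.
by have [_] := invs_evens_odds s; rewrite sL; lia.
Qed.

Lemma perm_evens_odds e : e <= L ->
  perm_eq [seq (evens s, odds s) | s <- bits (L + L) L & count id (evens s) == e]
          [seq (s0, s1) | s0 <- bits L e, s1 <- bits L (L - e)].
Proof.
move=> le_eL; apply: uniq_perm.
- rewrite map_inj_in_uniq ?filter_uniq ?bits_uniq // => s t _ _ [].
  exact: evens_odds_inj.
- by apply: allpairs_uniq; rewrite ?bits_uniq // => -[? ?] [? ?].
move=> [s0 s1]; apply/mapP/allpairsP => [[s]|[[t0 t1] /= [t0_bits t1_bits [-> ->]]]].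
  rewrite mem_filter => /andP[/eqP se s_bits] [-> ->].
  exists (evens s, odds s); have [so _] := count_evens_odds s_bits se.
  have [sz0 sz1] := size_evens_odds s.
  move: s_bits; rewrite !mem_bits /= => /andP[/eqP sL _].
  by rewrite se so sz0 sz1 sL addnn uphalf_double doubleK !eqxx.
move: t0_bits t1_bits; rewrite !mem_bits => /andP[/eqP z0 /eqP c0] /andP[/eqP z1 /eqP c1].
have [s [E0 E1]] := evens_odds_surj (etrans z0 (esym z1)).
exists s; last by rewrite E0 E1.
rewrite mem_filter E0 c0 eqxx mem_bits /=.
have [_ ->] := invs_evens_odds s; have [] := size_evens_odds s.
rewrite E0 E1 c0 c1 z0 z1 subnKC // eqxx andbT => h0 h1.
by have := odd_double_half (size s); have := uphalf_half (size s); lia.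
Qed.

(** On a fibre the total size of the quotient and the srank modulo 4 are both constant. *)
Definition fibre e := [seq s <- bits (L + L) L | (invs s == p) && (count id (evens s) == e)].

Lemma fibre_quot_size e s : s \in fibre e ->
  p + 'C(L, 2) = 2 * (invs (evens s) + invs (odds s) + 'C(e, 2) + 'C(L - e, 2)) + (L - e)
  /\ e <= L.
Proof.
rewrite mem_filter => /andP[/andP[/eqP sp /eqP se] s_bits].
have [so le_e] := count_evens_odds s_bits se; split=> //.
have [] := invs_evens_odds s; rewrite sp se so.
by move: s_bits; rewrite mem_bits => /andP[_ /eqP->] -> _; lia.
Qed.

Lemma quot_size_bounds e N : e <= L ->
  p + 'C(L, 2) = 2 * (N + 'C(e, 2) + 'C(L - e, 2)) + (L - e) ->
  [/\ N <= e, N <= L - e & 2 <= N %% 5].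
Proof.
move=> le_eL E.
have [d Ed] : exists d : int, (e%:Z = M%:Z + d)%R by exists (e%:Z - M%:Z)%R; lia.
(* In terms of the offset d = e - M, the size identity becomes quadratic in d alone. *)
have key : (p%:Z = 2 * N%:Z + 2 * d * d - d)%R.
  have := bin2_double L; have := bin2_double e; have := bin2_double (L - e).
  move: E; move: 'C(L, 2) 'C(e, 2) 'C(L - e, 2) => cL ce cf E.
  have [f Ef] : exists f, L - e = f by exists (L - e).
  rewrite Ef in E *; have Ef' : (f%:Z = M%:Z - d)%R by lia.
  have pred (k : nat) : ((k * k.-1)%N%:Z = k%:Z * k%:Z - k%:Z)%R by case: k => //= k; lia.
  move=> /(congr1 Posz); rewrite pred Ef' => Hf.
  move=> /(congr1 Posz); rewrite pred Ed => He.
  move=> /(congr1 Posz); rewrite pred => HL.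
  have EL : (L%:Z = 2 * M%:Z)%R by rewrite /L; lia.
  rewrite EL in HL; nia.
have d_ge : (- p%:Z <= d <= p%:Z)%R by nia.
split; [rewrite /L /M in Ed *; nia | rewrite /L /M in Ed *; nia | ].
have [q [r [Ed5 r5]]] : exists q r : int, (d = 5 * q + r /\ 0 <= r < 5)%R.
  by exists (d %/ 5)%Z, (d %% 5)%Z; lia.
(* Since p is 4 modulo 5, N is 2, 4, 4, 2, 3 modulo 5 for r = 0, ..., 4. *)
have {key} : (2 * N%:Z = 5 * (n%:Z - 2 * q * d - 2 * q * r + q) + (4 - 2 * r * r + r))%R.
  by move: key; rewrite Ed5 /p; lia.
move: (n%:Z - _ - _ + q)%R => w.
have : (r = 0 \/ r = 1 \/ r = 2 \/ r = 3 \/ r = 4)%R by lia.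
by case=> [->|[->|[->|[->|->]]]]; lia.
Qed.


(** The half words range independently over two boxes, so the sum is the coefficient of X^N in the
    product of their generating functions at z and z^4. The value N is read off a member, whence the
    separate empty case. *)
Lemma fibre_sum0 (z : algC) e : (5.-primitive_root z)%R ->
  (\sum_(s <- fibre e) z ^+ rank5 s = 0)%R.
Proof.
move=> z5; case E: (fibre e) => [|s0 W0]; first by rewrite big_nil.
have : s0 \in fibre e by rewrite E mem_head.
rewrite -{}E /fibre => /fibre_quot_size; move: (invs _ + invs _) => N [EN le_eL].
have [Ne Nf N5] := quot_size_bounds le_eL EN.
have eN : e + N <= L by lia.
have fN : L - e + N <= L by lia.
apply: etrans (boxgf_pair_coef z5 Ne eN Nf fN (leqnn N) N5).
rewrite !boxgf_bits big_distrlr /= coef_sum.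
under [RHS]eq_bigr => t0 _ do rewrite coef_sum.
transitivity (\sum_(x <- [seq (t0, t1) | t0 <- bits L e, t1 <- bits L (L - e)])
  (z ^+ gaps x.1 *: 'X^(invs x.1) * ((z ^+ 4) ^+ gaps x.2 *: 'X^(invs x.2)))`_N)%R;
  last by rewrite big_allpairs_dep.
rewrite -(perm_big _ (perm_evens_odds le_eL)) /= big_map !big_filter big_mkcond [RHS]big_mkcond /=.
apply: eq_big_seq => s s_bits; rewrite andbC; case: eqP => //= se.
rewrite -scalerAl -scalerAr scalerA -exprD coefZ coefXn -exprM -exprD.
have -> : (invs s == p) = (N == invs (evens s) + invs (odds s)).
  have [so _] := count_evens_odds s_bits se.
  have [] := invs_evens_odds s; rewrite se so.
  by move: s_bits; rewrite mem_bits => /andP[_ /eqP->] h _; apply/eqP/eqP; lia.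
by case: eqP; rewrite ?mulr1 ?mulr0.
Qed.

Lemma fibre_equidistributed e m : m < 5 ->
  5 * count (fun s => rank5 s %% 5 == m) (fibre e) = size (fibre e).
Proof. by move=> lt_m; apply: equidistributed_mod5 lt_m => z; apply: fibre_sum0. Qed.

Lemma srank_mod_word i s : s \in bits (L + L) L -> invs s = p ->
  srank_mod i (ptn_word s) =
  ((p%:Z + M%:Z - (count id (evens s))%:Z - i%:Z)%R %% 4 == 0)%Z.
Proof.
move=> s_bits sp; have [so le_e] := count_evens_odds s_bits erefl.
rewrite /srank_mod (srank_word _ s_bits) ?odd_double //.
have [t] := odd_trues_falses_mod8 s; rewrite sp so.
move: s_bits; rewrite mem_bits => /andP[/eqP s1 /eqP s2].
have s3 : count negb s = L.
  by have := count_predC id s; rewrite s1 s2 => /addnI <-; apply: eq_count.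
rewrite s1 s2 s3 addnn uphalf_double !odd_double expr0 mul1r.
(* The term 4 L M is thus a multiple of 8, and halving leaves a congruence modulo 4. *)
have -> : (L * M = 2 * (M * M)) by rewrite /L; lia.
move: (M * M) le_e => MM le_e; rewrite /L in le_e *; lia.
Qed.

Lemma quot2_rank_word m s : s \in bits (L + L) L -> m < 5 ->
  ((quot2_rank (ptn_word s) - m%:Z)%R %% 5 == 0)%Z = (rank5 s %% 5 == m).
Proof.
move=> s_bits lt_m5; rewrite /quot2_rank !(nu_quot_parts s_bits) //= /rank5.
lia.
Qed.

Lemma count_by_evens (P : pred bitseq) :
  count (fun s => (invs s == p) && P s) (bits (L + L) L) =
  \sum_(e < L.+1) count P (fibre e).
Proof.
under eq_bigr => e _ do rewrite count_filter.
have : {in bits (L + L) L, forall s, count id (evens s) < L.+1}.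
  by move=> s s_bits; rewrite ltnS; case: (count_evens_odds s_bits erefl).
elim: (bits _ _) => [|s l IHl] lt_L /=; first by rewrite big1.
rewrite big_split -IHl => [|t tl]; last by rewrite lt_L // inE tl orbT.
congr (_ + _); rewrite (bigD1 (Ordinal (lt_L s (mem_head s l)))) //= eqxx andbT.
rewrite big1 ?addn0 => [|e]; first by rewrite andbC.
by rewrite -val_eqE /= eq_sym => /negPf->; rewrite !andbF.
Qed.

End Fibres.

Unset Implicit Arguments.

Theorem theorem2 (n i m : nat) (hi : i = 0 \/ i = 2) (hm : m < 5) :
  ((card_ptn (5 * n + 4)
      (fun l => srank_mod i l && ((quot2_rank l - m%:Z)%R %% 5 == 0)%Z))%:R
   : rat)
  = ((p_i i (5 * n + 4))%:R / 5)%R.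
Proof.
set p := 5 * n + 4; pose M := p.*2; pose L := M.*2.
have le_pL : p <= L by rewrite /L /M; lia.
pose h (e : nat) := ((p%:Z + M%:Z - e%:Z - i%:Z)%R %% 4 == 0)%Z.
have srankE s : s \in bits (L + L) L -> invs s = p ->
  srank_mod i (ptn_word s) = h (count id (evens s)) by exact: srank_mod_word.
suff E : 5 * card_ptn p (fun l => srank_mod i l && ((quot2_rank l - m%:Z)%R %% 5 == 0)%Z)
    = p_i i p.
  by rewrite -E natrM mulrC mulKf.
rewrite /p_i !(card_ptn_words _ le_pL).
pose Q s := h (count id (evens s)).
have -> : count (fun s => (invs s == p) && srank_mod i (ptn_word s)) (bits (L + L) L)
    = \sum_(e < L.+1) count Q (fibre n e).
  rewrite -count_by_evens; apply: eq_in_count => s s_bits.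
  by apply: andb_id2l => /eqP sp; rewrite srankE.
have -> : count (fun s => (invs s == p) && (srank_mod i (ptn_word s) &&
      ((quot2_rank (ptn_word s) - m%:Z)%R %% 5 == 0)%Z)) (bits (L + L) L)
    = \sum_(e < L.+1) count (fun s => Q s && (rank5 s %% 5 == m)) (fibre n e).
  rewrite -count_by_evens; apply: eq_in_count => s s_bits.
  by apply: andb_id2l => /eqP sp; rewrite srankE // (quot2_rank_word s_bits).
rewrite big_distrr; apply: eq_bigr => e _ /=.
(* The srank condition keeps a whole fibre or none of it, so equidistribution applies fibre by
   fibre. *)
have QE s : s \in fibre n e -> Q s = h e.
  by rewrite mem_filter /Q => /andP[/andP[_ /eqP->]].
rewrite (eq_in_count (a2 := fun s => h e && (rank5 s %% 5 == m))); last first.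
  by move=> s /QE->.
rewrite (@eq_in_count _ Q (fun=> h e)); last by move=> s /QE->.
case: (h e); last by rewrite !count_pred0.
by rewrite fibre_equidistributed // count_predT.
Qed.
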